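(* Define $$\beta_G^*=\min_{m\in\mathbb R_+^K,\ \bar m\in\mathbb R_+^I}\ \sum_{(j,i)\in\mathcal K:\,m_j>0} m_{ji}\log\frac{m_{ji}C_j}{m_j}-\sum_{i\in\mathcal I}G_i(\bar m_i)\quad\text{subject to}\quad\sum_{j\in i}m_{ji}=\bar m_i,\ i\in\mathcal I. \tag{P}$$ Then $$\beta_G^*=\max_{\Lambda\in\mathbb R_+^I}\ \sum_{i\in\mathcal I}U_i(\Lambda_i)\quad\text{subject to}\quad\sum_{i:\,j\in i}\Lambda_i\le C_j,\ j\in\mathcal J. \tag{D}$$ Moreover, for $(m^*,\bar m^* )\in\mathbb R_+^K\times\mathbb R_+^I$ and $\Lambda^*\in\mathbb R_+^I$: $(m^*,\bar m^* )$ optimizes (P) and $\Lambda^*$ optimizes (D) if and only if all of the following hold: $$\sum_{j\in i}m^*_{ji}=\bar m_i^*\quad\forall i\in\mathcal I,\qquad \sum_{i:\,j\in i}\Lambda_i^*\le C_j\quad\forall j\in\mathcal J,$$ $$m_j^*\Lambda_i^*=m_{ji}^*C_j\quad\forall (j,i)\in\mathcal K,\qquad e^{G_i'(\bar m_i^* )}=\Lambda_i^*\quad\forall i\in\mathcal I,$$ where $G_i'$ is the derivative of $G_i$.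
   Context: $\mathcal J$ is a finite set (queues); $\mathcal I$ is a finite set of routes, each route $i\in\mathcal I$ being a non-empty subset of $\mathcal J$. $\mathcal K=\{(j,i)\in\mathcal J\times\mathcal I:j\in i\}$, $I=|\mathcal I|$, $K=|\mathcal K|$, and $C_j\in(0,\infty)$ for $j\in\mathcal J$. For $m=(m_{ji}:(j,i)\in\mathcal K)\in\mathbb R_+^K$ put $m_j=\sum_{i:j\in i}m_{ji}$ (and likewise $m_j^*$ from $m^*$). Convention: $0\log 0=0$, so terms with $m_{ji}=0$ contribute $0$. For each $i$, $U_i$ is an increasing, strictly concave, differentiable real function on $(0,\infty)$ with $U_i'(\Lambda)\to\infty$ as $\Lambda\to0$, and $U_i(0)=\lim_{\Lambda\downarrow0}U_i(\Lambda)\in[-\infty,\infty)$. Define $G_i:\mathbb R_+\to[-\infty,\infty)$ by $$-G_i(\bar m_i)=\sup_{\lambda_i\in\mathbb R}\{U_i(e^{\lambda_i})-\bar m_i\lambda_i\},\qquad \bar m_i\in\mathbb R_+ .$$ Assumption 1: $\lambda\mapsto U_i(e^\lambda)$ is strictly concave on $\mathbb R$. Assumption 2: $G_i$ is strictly concave, continuously differentiable on $(0,\infty)$, with derivative taking all values in $\mathbb R$. By Legendre–Fenchel duality, $U_i(e^{\lambda_i})=\min_{\bar m_i\in\mathbb R_+}\{\lambda_i\bar m_i-G_i(\bar m_i)\}$, $\lambda_i\in\mathbb R$. The condition $e^{G_i'(\bar m_i^* )}=\Lambda_i^*$ is understood to require $\bar m_i^*>0$. *)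

(* Defs.v *)
From HB Require Import structures.
From mathcomp Require Import all_boot all_order all_algebra.
From mathcomp Require Import all_classical all_reals all_analysis.
Set Implicit Arguments.
Unset Strict Implicit.
Unset Printing Implicit Defensive.
Import Order.TTheory GRing.Theory Num.Theory.
Import numFieldNormedType.Exports.
Local Open Scope classical_set_scope.
Local Open Scope ring_scope.

(* A set of routes is a {set {set J}}; its members form a finType, used to
   index vectors in R^I, and the incident pairs (j, i), j \in i, form a finType
   used to index vectors in R^K. *)
Notation route routes := {i : {set _} | i \in routes}.
Notation incidence routes := {k : _ * route routes | k.1 \in val k.2}.

Section Convexity.
Context {R : realType}.

Definition strictly_concave_on (D : set R) (f : R -> R) :=
  forall x y t : R, D x -> D y -> x != y -> 0 < t < 1 ->
    t * f x + (1 - t) * f y < f (t * x + (1 - t) * y).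

End Convexity.

Section Extrema.
Context {R : realType} {T : Type}.
Local Open Scope ereal_scope.

Definition is_min (A : set (\bar R)) (v : \bar R) := A v /\ lbound A v.
Definition is_max (A : set (\bar R)) (v : \bar R) := A v /\ ubound A v.

Definition minimizes (S : set T) (f : T -> \bar R) (x : T) :=
  S x /\ forall y, S y -> f x <= f y.
Definition maximizes (S : set T) (f : T -> \bar R) (x : T) :=
  S x /\ forall y, S y -> f y <= f x.

End Extrema.

Section Utility.
Context {R : realType}.
Implicit Type u : R -> R.

(* Only the values of u on ]0, +oo[ are meaningful; the value at 0 is the
   right limit, possibly -oo. *)
Definition utility_ext u (x : R) : \bar R :=
  if x == 0 then lim ((u y)%:E @[y --> 0^'+]) else (u x)%:E.

(* G, characterized on the arguments m >= 0 by
   - G m = sup_l (u (exp l) - m * l); it takes values in [-oo, +oo[. *)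
Definition conj_util u (m : R) : \bar R :=
  (- ereal_sup [set (u (expR l) - m * l)%:E | l in [set: R]])%E.

(* The real-valued version, meaningful where conj_util u is finite. *)
Definition conj_util_fin u (m : R) : R := fine (conj_util u m).

End Utility.

Section Network.
Context {R : realType} {J : finType} (routes : {set {set J}}).
Variables (C : J -> R) (U : route routes -> R -> R).
Implicit Types (m : incidence routes -> R) (mbar L : route routes -> R).

Definition queue_total m (j : J) : R := \sum_(k | (val k).1 == j) m k.
Definition route_total m (i : route routes) : R := \sum_(k | (val k).2 == i) m k.

Definition nonneg (T : Type) (v : T -> R) := forall t, 0 <= v t.

Definition primal_feasible : set ((incidence routes -> R) * (route routes -> R)) :=
  [set p | [/\ nonneg p.1, nonneg p.2 & forall i, route_total p.1 i = p.2 i]].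

(* ln 0 = 0 in the library, so terms with m k = 0 vanish. *)
Definition primal_objective
    (p : (incidence routes -> R) * (route routes -> R)) : \bar R :=
  ((\sum_(k | 0 < queue_total p.1 (val k).1)
      p.1 k * ln (p.1 k * C (val k).1 / queue_total p.1 (val k).1))%:E
   - \sum_i conj_util (U i) (p.2 i))%E.

Definition capacity_ok L :=
  forall j : J, \sum_(i : route routes | j \in val i) L i <= C j.

Definition dual_feasible : set (route routes -> R) :=
  [set L | nonneg L /\ capacity_ok L].

Definition dual_objective L : \bar R := (\sum_i utility_ext (U i) (L i))%E.

Definition beta_G : \bar R := ereal_inf (primal_objective @` primal_feasible).

End Network.

Arguments primal_feasible {R J} routes.
Arguments dual_feasible {R J} routes C.

(* Main.v *)
(* Weak duality combines - G m >= U (exp l) - m l with Gibbs' inequality in each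
   queue, a ln (a c / Q) - a ln L >= a - Q L / c, summed using the capacity
   constraints; equality in both is exactly the optimality system.  That system
   has a solution: in the variables l = ln L the dual objective is continuous
   and tends to -oo as some l_i -> -oo, so it has a maximizer L; Farkas' lemma
   gives multipliers p_j >= 0, supported on the tight queues, with
   U_i' (L_i) = \sum_(j in i) p_j, and m_ji := p_j L_i does the job, because
   m_j = p_j C_j and \sum_(j in i) m_ji = L_i U_i' (L_i) is the point where
   G_i' equals ln L_i. *)
Require Import Defs.
From mathcomp Require Import all_boot all_order all_algebra.
From mathcomp Require Import all_classical all_reals all_analysis.
From mathcomp Require Import ring lra.
Set Implicit Arguments.
Unset Strict Implicit.
Unset Printing Implicit Defensive.
Import Order.TTheory GRing.Theory Num.Theory.
Import numFieldNormedType.Exports.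
Local Open Scope classical_set_scope.
Local Open Scope ring_scope.

(** * Maxima over boxes, and Farkas' lemma for nonnegative matrices *)

Section BoxExtrema.
Import ArrowAsProduct.

Lemma continuous_coord (R : realType) (I : finType) (i : I) :
  continuous (fun x : I -> R => x i).
Proof. exact: (@proj_continuous I (fun=> R) i). Qed.

Lemma continuous_sum_fin (R : realType) (T : topologicalType) (K : finType)
    (P : pred K) (f : K -> T -> R) :
  (forall k, continuous (f k)) -> continuous (fun x => \sum_(k | P k) f k x).
Proof.
move=> cf x; apply: (@cvg_big R K +%R 0 P) => [|k _]; last exact: cf.
exact: add_continuous.
Qed.

(** [ArrowAsProduct] gives [I -> R] the product topology, so the box is compact by Tychonoff's
    theorem, and so is its intersection with the closed set [S]. *)
Lemma box_EVT_max (R : realType) (I : finType) (a b : I -> R)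
    (S : set (I -> R)) (f : (I -> R) -> R) :
    (exists x, S x /\ forall i, a i <= x i <= b i) ->
    closed S -> continuous f ->
  exists x, [/\ S x, forall i, a i <= x i <= b i
    & forall y, S y -> (forall i, a i <= y i <= b i) -> f y <= f x].
Proof.
move=> [x [Sx xab]] cS cf.
pose B := [set y : I -> R | forall i, `[a i, b i]%classic (y i)].
have cB : compact (B `&` S).
  apply: compact_closedI cS.
  exact: (@tychonoff I (fun=> R) _ (fun i => @segment_compact R (a i) (b i))).
have [||z /set_mem[Bz Sz] zmax] := compact_EVT_max _ cB (f := f).
- by exists x; split=> // i /=; rewrite in_itv /= xab.
- exact: continuous_subspaceT.
exists z; split=> // y Sy yab.
by apply: zmax; apply/mem_set; split=> // i /=; rewrite in_itv /= yab.
Qed.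


Lemma continuous_sum_coord (R : realType) (I : finType) (P : pred I)
    (v : I -> R -> R) :
  (forall i, continuous (v i)) ->
  continuous (fun x : I -> R => \sum_(i | P i) v i (x i)).
Proof.
move=> cv; apply: (@continuous_sum_fin R (I -> R) I P (fun i x => v i (x i))).
by move=> i x; exact: continuous_comp (@continuous_coord R I i x) (cv i _).
Qed.

(** Separable case, for the dual problem in logarithmic variables. Its statement mentions no
    topology on [I -> R], so it can be used outside this section. *)
Lemma box_EVT_max_sum (R : realType) (I J : finType) (a b : I -> R)
    (P : J -> pred I) (w v : I -> R -> R) (C : J -> R) :
    (forall i, continuous (w i)) -> (forall i, continuous (v i)) ->
    let S := [set x : I -> R | forall j, \sum_(i | P j i) w i (x i) <= C j] in
    (exists x, S x /\ forall i, a i <= x i <= b i) ->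
  exists x, [/\ S x, forall i, a i <= x i <= b i
    & forall y, S y -> (forall i, a i <= y i <= b i) ->
      \sum_i v i (y i) <= \sum_i v i (x i)].
Proof.
move=> cw cv S Sne.
apply: (@box_EVT_max R I a b S (fun x => \sum_i v i (x i))) => //; last first.
  exact: continuous_sum_coord.
have -> : S = \bigcap_(j in setT)
    (fun x : I -> R => \sum_(i | P j i) w i (x i)) @^-1` [set y | y <= C j].
  by apply/seteqP; split=> [x Sx j _ | x Sx j]; [exact: Sx | exact: (Sx j)].
apply: closed_bigI => j _.
have /continuous_closedP := @continuous_sum_coord R I (P j) w cw.
by apply; exact: closed_le.
Qed.

Lemma continuous_neg_sum_sqr (R : realType) (T : topologicalType)
    (J I : finType) (A : J -> I -> R) (c : I -> R) (p : J -> T -> R) :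
    (forall j, continuous (p j)) ->
  continuous (fun x => - \sum_i (c i - \sum_j p j x * A j i) ^+ 2).
Proof.
move=> cp x; apply: cvgN; apply: continuous_sum_fin => i {}x.
apply: (@continuous_comp T R R (fun x => c i - \sum_j p j x * A j i)
  (fun y : R => y ^+ 2)); last exact: exprn_continuous.
apply: cvgB; first exact: cvg_cst.
by apply: continuous_sum_fin => j {}x; apply: cvgMr_tmp; exact: cp.
Qed.

(** For small [t] the linear term dominates: if [g > 0], any positive [t <= g / (h + 1)] gives
    [t * h < 2 * g]. The [+ 1] keeps the denominator positive when [h = 0]. *)
Lemma quadratic_ge0_slope (R : realFieldType) (w g h : R) : 0 < w -> 0 <= h ->
  (forall t, 0 < t <= w -> 0 <= t ^+ 2 * h - 2 * t * g) -> g <= 0.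
Proof.
move=> w0 h0 tP; rewrite leNgt; apply/negP => g0.
have h1 : 0 < h + 1 by lra.
pose t := Num.min w (g / (h + 1)).
have t0 : 0 < t by rewrite lt_min w0 divr_gt0.
have tw : t <= w by rewrite ge_min lexx.
have tg : t * (h + 1) <= g.
  by rewrite -ler_pdivlMr // ge_min lexx orbT.
have := tP t; rewrite t0 tw => /(_ isT); apply/negP; rewrite -ltNge.
rewrite (_ : _ - _ = t * (t * h - 2 * g)); last by ring.
rewrite pmulr_rlt0 //; lra.
Qed.

(* For a nonnegative matrix, projecting [c] onto the cone spanned by the rows
   amounts to minimizing a quadratic over a large enough box; the residual [r]
   satisfies [A r <= 0], hence [r . r = c . r <= 0]. *)
Lemma farkas_nonneg (R : realType) (J I : finType) (A : J -> I -> R)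
    (c : I -> R) :
    (forall j i, 0 <= A j i) ->
    (forall d : I -> R, (forall j, \sum_i A j i * d i <= 0) ->
      \sum_i c i * d i <= 0) ->
  exists p : J -> R,
    (forall j, 0 <= p j) /\ forall i, c i = \sum_j p j * A j i.
Proof.
move=> A0 cA.
(* [s ^+ 2] exceeds the squared norm of [c], which is the objective at [p = 0]; hence no coordinate
   of the minimal residual lies below [- s]. *)
pose s : R := 1 + \sum_i c i ^+ 2.
have c20 : 0 <= \sum_i c i ^+ 2 by apply: sumr_ge0 => i _; exact: sqr_ge0.
have s0 : 0 < s by rewrite /s; lra.
have term0 j i : 0 <= (`|c i| + s) / A j i.
  by rewrite divr_ge0 // addr_ge0 // ltW.
(* Side of the box: [p j = P] with [A j i > 0] pushes the residual at [i] below [- s]. Entries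
   [A j i = 0] add 0 to the sum, since division by 0 gives 0. *)
pose P : R := 1 + \sum_j \sum_i (`|c i| + s) / A j i.
have P0 : 0 < P.
  by rewrite ltr_wpDr // sumr_ge0 // => j _; rewrite sumr_ge0.
have PA j i : 0 < A j i -> c i + s < P * A j i.
  move=> Aji; rewrite -ltr_pdivrMr //.
  apply: (@le_lt_trans _ _ ((`|c i| + s) / A j i)).
    by rewrite ler_pM2r ?invr_gt0 // lerD2r ler_norm.
  have : \sum_j \sum_i (`|c i| + s) / A j i < P by rewrite ltrDr.
  apply: le_lt_trans.
  rewrite (bigD1 j) //= (bigD1 i) //= -addrA lerDl addr_ge0 //.
    exact: sumr_ge0.
  by apply: sumr_ge0 => j' _; exact: sumr_ge0.
pose r (p : J -> R) i := c i - \sum_j p j * A j i.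
have [|||p [_ pP pmax]] := @box_EVT_max R J (fun=> 0) (fun=> P) setT
    (fun p => - \sum_i r p i ^+ 2).
- by exists (fun=> 0); split=> // j; rewrite lexx ltW.
- exact: closedT.
- exact: (@continuous_neg_sum_sqr R _ J I A c (fun j x => x j)
    (@continuous_coord R J)).
pose g j := \sum_i A j i * r p i.
pose h j := \sum_i A j i ^+ 2.
have h0 j : 0 <= h j by apply: sumr_ge0 => i _; exact: sqr_ge0.
(* Changing [p j] by [t] changes the squared residual by [t ^+ 2 * h j - 2 * t * g j], which
   minimality makes nonnegative. *)
have step j t : 0 <= p j + t <= P -> 0 <= t ^+ 2 * h j - 2 * t * g j.
  move=> ptP; pose y j' := p j' + (if j' == j then t else 0).
  have yP j' : 0 <= y j' <= P.
    by rewrite /y; case: eqP => [->//|_]; rewrite addr0.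
  have := pmax y Logic.I yP; rewrite lerN2 => {}pmax.
  rewrite -subr_ge0 in pmax; apply: le_trans pmax _.
  rewrite /h /g !mulr_sumr -!sumrB; apply: ler_sum => i _.
  have -> : r y i = r p i - t * A j i.
    rewrite /r -addrA -opprD; congr (_ - _).
    under eq_bigr do rewrite mulrDl.
    rewrite big_split /=; congr (_ + _).
    rewrite (bigD1 j) //= eqxx big1 ?addr0 // => j' /negbTE ->.
    by rewrite mul0r.
  by rewrite le_eqVlt; apply/orP; left; apply/eqP; ring.
have g_le0 j : p j < P -> g j <= 0.
  move=> pjP; apply: (@quadratic_ge0_slope _ (P - p j) _ _ _ (h0 j)).
    by rewrite subr_gt0.
  move=> t /andP[t0 tP].
  by apply: step; have /andP[] := pP j; lra.
have g_ge0 j : 0 < p j -> 0 <= g j.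
  move=> pj0; rewrite -oppr_le0.
  apply: (quadratic_ge0_slope pj0 (h0 j)) => t /andP[t0 tp].
  rewrite (_ : _ - _ = (- t) ^+ 2 * h j - 2 * (- t) * g j); last by ring.
  by apply: step; have /andP[] := pP j; lra.
(* On the upper face the choice of [P] would make the residual worse than at [p = 0], unless row [j]
   of [A] is zero. *)
have g_top j : p j = P -> g j = 0.
  move=> pjP; apply: big1 => i _.
  have := A0 j i; rewrite le_eqVlt => /predU1P[<-|Aji]; first by rewrite mul0r.
  exfalso; have ri : r p i < - s.
    rewrite /r (bigD1 j) //= pjP.
    have := PA _ _ Aji.
    have : 0 <= \sum_(j' | j' != j) p j' * A j' i.
      by apply: sumr_ge0 => j' _; rewrite mulr_ge0 //; have /andP[] := pP j'.
    lra.
  have pmax0 : \sum_i r p i ^+ 2 <= \sum_i r (fun=> 0) i ^+ 2.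
    by rewrite -lerN2; apply: pmax => // j'; rewrite lexx ltW.
  move: pmax0.
  have -> : \sum_i r (fun=> 0) i ^+ 2 = \sum_i c i ^+ 2.
    by apply: eq_bigr => k _; rewrite /r big1 ?subr0 // => j' _; rewrite mul0r.
  rewrite (bigD1 i) //=.
  have : 0 <= \sum_(k | k != i) r p k ^+ 2.
    by apply: sumr_ge0 => k _; exact: sqr_ge0.
  have : s ^+ 2 < r p i ^+ 2 by nra.
  by rewrite /s in s0 *; nra.
have gj0 j : g j <= 0.
  by have /andP[_] := pP j; rewrite le_eqVlt => /predU1P[/g_top->|/g_le0].
have pg j : p j * g j = 0.
  have /andP[+ pjP] := pP j; rewrite le_eqVlt => /predU1P[<-|pj0].
    by rewrite mul0r.
  by rewrite (@le_anti _ _ (g j) 0) ?mulr0 // gj0 g_ge0.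
exists p; split=> [j|i]; first by have /andP[] := pP j.
have rr : \sum_i r p i ^+ 2 <= 0.
  apply: le_trans (cA _ gj0); rewrite -subr_ge0 -sumrB.
  have -> : \sum_i (c i * r p i - r p i ^+ 2) = \sum_j p j * g j.
    under [RHS]eq_bigr do rewrite /g mulr_sumr.
    rewrite exchange_big /=; apply: eq_bigr => k _.
    under eq_bigr do rewrite mulrA.
    by rewrite -mulr_suml {2}/r expr2 -mulrBl opprB addrC subrK.
  by rewrite big1.
have r0 : \sum_i r p i ^+ 2 = 0.
  by apply: le_anti; rewrite rr sumr_ge0 // => k _; exact: sqr_ge0.
have /eqP := psumr_eq0P (fun k _ => sqr_ge0 (r p k)) r0 (erefl : xpredT i).
by rewrite sqrf_eq0 subr_eq0 => /eqP.
Qed.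

End BoxExtrema.

(** * Conjugacy between one utility in logarithmic scale and its [G] *)

Section Conjugate.
Variables (R : realType) (u : R -> R).
Implicit Types x y l : R.

Lemma conj_util_ge x l : ((u (expR l) - x * l)%:E <= - conj_util u x)%E.
Proof. by rewrite oppeK; apply: ereal_sup_ubound; exists l. Qed.

Hypothesis u_incr : forall x y, 0 < x -> x < y -> u x < u y.
Hypothesis u_derivable : forall x, 0 < x -> derivable u x 1.
Hypothesis G_fin : forall x, 0 < x -> conj_util u x \is a fin_num.
Hypothesis G_derivable : forall x, 0 < x -> derivable (conj_util_fin u) x 1.
Hypothesis G_onto :
  forall y, exists2 x, 0 < x & derive1 (conj_util_fin u) x = y.

Lemma conj_util_finE x : 0 < x -> conj_util u x = (conj_util_fin u x)%:E.
Proof. by move=> x0; rewrite fineK // G_fin. Qed.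

Lemma conj_util_fin_ge x l : 0 < x ->
  u (expR l) - x * l <= - conj_util_fin u x.
Proof.
by move=> x0; rewrite -lee_fin EFinN -conj_util_finE //; exact: conj_util_ge.
Qed.

(** Envelope argument: [G z - z * l] is at most [- u (expR l)] for every [z > 0], with equality at
    [x], so [x] is an interior maximum and the derivative there vanishes. *)
Lemma derive1_conj_util x l : 0 < x ->
  - conj_util_fin u x = u (expR l) - x * l ->
  derive1 (conj_util_fin u) x = l.
Proof.
move=> x0 xl; set G := conj_util_fin u in xl *.
have dG y : 0 < y -> is_derive y 1 G (derive1 G y).
  by move=> y0; rewrite derive1E; apply: derivableP; exact: G_derivable.
have dH y : 0 < y -> is_derive y 1 (fun z => G z - z * l) (derive1 G y - l).
  move=> y0; have /is_derive_eq := is_deriveB (dG _ y0)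
    (is_deriveM (is_derive_id y 1) (is_derive_cst l y 1)).
  by apply; rewrite /= scaler0 add0r -[l *: 1]/(l * 1) mulr1.
have xI : x \in `]0, (x + 1)[ by rewrite in_itv /= x0 ltrDl ltr01.
have H0 : is_derive x 1 (fun z => G z - z * l) 0.
  apply: (derive1_at_max _ _ xI) => [|y|y]; rewrite ?in_itv /=; first lra.
    by move=> /andP[y0 _]; have [] := dH _ y0.
  by move=> /andP[y0 _]; have := conj_util_fin_ge l y0; rewrite -/G; lra.
by have := dH _ x0; case=> _ e1; case: H0 => _ e2; lra.
Qed.

Lemma util_exp_continuous : continuous (fun l => u (expR l)).
Proof.
move=> l; apply: continuous_comp; first exact: continuous_expR.
by apply/differentiable_continuous/derivable1_diffP/u_derivable/expR_gt0.
Qed.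

(** Finiteness of [G] at [x / 2] and [x * 2] bounds [u (expR l)] by affine functions of slopes below
    and above [x]. Hence [u (expR l) - x * l] tends to -oo at both ends, and the supremum is a
    maximum over a segment. *)
Lemma conj_util_attained x : 0 < x ->
  exists l, - conj_util_fin u x = u (expR l) - x * l.
Proof.
move=> x0; set V := fun l => u (expR l).
pose a := - conj_util_fin u (x / 2); pose b := - conj_util_fin u (x * 2).
have Va l : V l - x * l <= a - x / 2 * l.
  by have := @conj_util_fin_ge (x / 2) l; rewrite -/a -/(V l); lra.
have Vb l : V l - x * l <= b + x * l.
  by have := @conj_util_fin_ge (x * 2) l; rewrite -/b -/(V l); lra.
(* Beyond [M] the bound [Va], and below [- M] the bound [Vb], is at most [V 0], the value at
   [l = 0]. *)
pose M := (`|a - V 0| + `|b - V 0|) * 2 / x.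
have M0 : 0 <= M by rewrite divr_ge0 ?mulr_ge0 ?addr_ge0 // ltW.
have xM : x * M = (`|a - V 0| + `|b - V 0|) * 2.
  by rewrite /M mulrCA divff ?mulr1 // gt_eqF.
have cW : continuous (fun l => V l - x * l).
  move=> l; apply: cvgB; first exact: util_exp_continuous.
  by apply: cvgMl_tmp; exact: cvg_id.
have [l lM lmax] := @EVT_max R _ _ _ (ge0_cp M0).2 (continuous_subspaceT cW).
exists l; apply/eqP; rewrite eq_le conj_util_fin_ge // andbT.
rewrite -lee_fin EFinN -conj_util_finE // oppeK; apply: ge_ereal_sup.
move=> _ [k _ <-]; rewrite lee_fin -/(V k) -/(V l).
have l0 : V 0 <= V l - x * l.
  by have := lmax 0; rewrite mulr0 subr0; apply; rewrite in_itv /= oppr_le0 M0.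
have na := ler_norm (a - V 0); have nb := ler_norm (b - V 0).
have na0 := normr_ge0 (a - V 0); have nb0 := normr_ge0 (b - V 0).
have [kM|kM] := ltP k (- M).
  by apply: le_trans (Vb k) _; nra.
have [Mk|Mk] := ltP M k.
  by apply: le_trans (Va k) _; nra.
by apply: lmax; rewrite in_itv /= kM Mk.
Qed.

Lemma conj_util_derive1E x : 0 < x ->
  - conj_util_fin u x =
    u (expR (derive1 (conj_util_fin u) x)) - x * derive1 (conj_util_fin u) x.
Proof.
move=> x0; have [l xl] := conj_util_attained x0.
by rewrite (derive1_conj_util x0 xl).
Qed.

(** Since the derivative of [G] is onto, [u \o expR] has at every [l] a supporting line, of positive
    slope [x]. *)
Lemma conj_util_slope l : exists x, [/\ 0 < x,
  derive1 (conj_util_fin u) x = l &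
  forall k, u (expR k) - x * k <= u (expR l) - x * l].
Proof.
have [x x0 xl] := G_onto l; exists x; split=> // k.
by have := conj_util_derive1E x0; rewrite xl => <-; exact: conj_util_fin_ge.
Qed.

(** The supporting line at 0 has positive slope, so it drags [u (expR l)] to -oo as [l] does. *)
Lemma util_exp_lt (A : R) : exists a, forall l, l < a -> u (expR l) < A.
Proof.
have [x [x0 _ xV]] := conj_util_slope 0.
exists ((A - u 1) / x) => l; rewrite ltr_pdivlMr // => lA.
have := xV l; rewrite expR0; lra.
Qed.

(** At [x = 0] the supremum is over the strictly increasing [u \o expR], so it is not attained. *)
Lemma conj_util_eq_gt0 x l : 0 <= x ->
  (- conj_util u x = (u (expR l) - x * l)%:E)%E -> 0 < x.
Proof.
rewrite le_eqVlt => /predU1P[<-|//] xl.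
have := conj_util_ge 0 (l + 1); rewrite xl lee_fin !mul0r !subr0 leNgt.
by rewrite u_incr ?expR_gt0 // ltr_expR ltrDl.
Qed.

(** This keeps dual points of finite value off the boundary, so that their logarithms are
    meaningful. *)
Lemma utility_ext0 : utility_ext u 0 = -oo%E.
Proof.
rewrite /utility_ext eqxx; apply: cvg_lim => //.
apply/cvgerNyP/cvgrNyPle => A.
have [a aA] := util_exp_lt A.
have /cvgrNyPlt/(_ a) lna := @lnNy R.
near=> y; have y0 : 0 < y by near: y; exact: nbhs_right_gt.
by rewrite -(lnK y0) ltW // aA //; near: y.
Unshelve. all: by end_near. Qed.

(** The supporting line in the variable [ln z] says that [u z - x * ln z] is maximal at [expR l];
    its derivative vanishes there. *)
Lemma is_derive_util l x : (forall k, u (expR k) - x * k <= u (expR l) - x * l) ->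
  is_derive (expR l) 1 u (x / expR l).
Proof.
move=> xl; set y := expR l; have y0 : 0 < y by exact: expR_gt0.
have du (z : R) : 0 < z -> is_derive z 1 u ('D_1 u z).
  by move=> z0; apply: derivableP; exact: u_derivable.
have dH (z : R) : 0 < z ->
    is_derive z 1 (fun z => u z - x * ln z) ('D_1 u z - x / z).
  move=> z0; have /is_derive_eq := is_deriveB (du _ z0)
    (is_deriveM (is_derive_cst x z 1) (is_derive1_ln z0)).
  by apply; rewrite /= scaler0 addr0.
have yI : y \in `]0, (y + 1)[ by rewrite in_itv /= y0 ltrDl ltr01.
have H0 : is_derive y 1 (fun z => u z - x * ln z) 0.
  apply: (derive1_at_max _ _ yI) => [|z|z]; rewrite ?in_itv /=; first lra.
    by move=> /andP[z0 _]; have [] := dH _ z0.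
  by move=> /andP[z0 _]; have := xl (ln z); rewrite lnK // /y expRK.
apply: (is_derive_eq (du _ y0)).
by have := dH _ y0; case=> _ e1; case: H0 => _ e2; lra.
Qed.

End Conjugate.

(** * First-order conditions along a ray, and Gibbs' inequality *)

Section FirstOrder.
Variable R : realType.

Lemma is_derive_quotient (f : R -> R) (x a : R) : is_derive x 1 f a ->
  h^-1 * (f (x + h) - f x) @[h --> 0^'] --> a.
Proof.
move=> [df <-]; apply: cvg_trans df; apply: near_eq_cvg.
by near=> h; rewrite /= [h%:A]mulr1 [h + x]addrC.
Unshelve. all: by end_near. Qed.

Lemma near_right_mulr_lt (a s : R) : 0 < s -> \forall t \near 0^'+, t * a < s.
Proof.
move=> s0; near=> t.
have t0 : 0 < t by near: t; exact: nbhs_right_gt.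
apply: (@le_lt_trans _ _ (t * (`|a| + 1))).
  by rewrite ler_pM2l //; have := ler_norm a; lra.
rewrite -ltr_pdivlMr; last by have := normr_ge0 a; lra.
by near: t; apply: nbhs_right_lt; rewrite divr_gt0.
Unshelve. all: by end_near. Qed.

(** Maximality is assumed for small positive [t] only, since a feasible direction need not be
    reversible; right difference quotients suffice for the sign. *)
Lemma sum_slope_le0 (I : finType) (v : I -> R -> R) (c : I -> R) :
    (forall i, is_derive (0 : R) 1 (v i) (c i)) ->
    (\forall t \near 0^'+, \sum_i v i t <= \sum_i v i 0) ->
  \sum_i c i <= 0.
Proof.
move=> dv vmax.
have cq : \sum_i t^-1 * (v i t - v i 0) @[t --> 0^'+] --> \sum_i c i.
  apply: (@cvg_big R I +%R 0 xpredT (@add_continuous _)) => i _.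
  have := is_derive_quotient (dv i); under eq_fun do rewrite add0r.
  exact: cvg_dnbhs_at_right.
apply: (@cvgr_to_le _ _ _ _ _ _ _ cq); near=> t.
have t0 : 0 < t by near: t; exact: nbhs_right_gt.
rewrite -mulr_sumr pmulr_rle0 ?invr_gt0 // sumrB subr_le0.
by near: t.
Unshelve. all: by end_near. Qed.

End FirstOrder.

(** For [a > 0] and [z := Q * L / (a * c)] the gap is [a * (z - 1 - ln z)], which is nonnegative and
    vanishes only at [z = 1]. For [a = 0] the gap is [Q * L / c > 0], and [Q * L = 0] fails too. *)
Lemma entropy_term_ge (R : realType) (a Q c L : R) :
    0 <= a -> 0 < Q -> 0 < c -> 0 < L ->
  a - Q * L / c <= a * ln (a * c / Q) - a * ln L ?= iff (Q * L == a * c).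
Proof.
move=> a0 Q0 c0 L0; have QL0 : 0 < Q * L / c by rewrite divr_gt0 ?mulr_gt0.
move: a0; rewrite le_eqVlt => /predU1P[<-|a0].
  rewrite !mul0r subr0 sub0r; split; first by rewrite oppr_le0 ltW.
  by rewrite oppr_eq0 !gt_eqF // mulr_gt0.
pose z := Q * L / (a * c); have z0 : 0 < z by rewrite divr_gt0 ?mulr_gt0.
have -> : a * ln (a * c / Q) - a * ln L = a - Q * L / c + a * (z - (1 + ln z)).
  have -> : Q * L / c = a * z by rewrite /z; field; rewrite !gt_eqF.
  have -> : a * c / Q = L / z by rewrite /z; field; rewrite !gt_eqF.
  by rewrite ln_div ?posrE //; ring.
have [z1|z1] := eqVneq (ln z) 0.
  have {}z1 : z = 1 by rewrite -(lnK z0) z1 expR0.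
  have ac0 : a * c != 0 by rewrite gt_eqF ?mulr_gt0.
  rewrite z1 ln1 addr0 subrr mulr0 addr0; split=> //; rewrite eqxx; apply/esym.
  by apply/eqP; rewrite -[LHS](divfK ac0) -/z z1 mul1r.
have zz : 1 + ln z < z by rewrite -[ltRHS](lnK z0) expR_gt1Dx.
have pos : 0 < a * (z - (1 + ln z)) by rewrite mulr_gt0 // subr_gt0.
split; first by rewrite lerDl ltW.
rewrite -subr_eq0 opprD addrA subrr sub0r oppr_eq0 gt_eqF //; apply/esym.
apply/negbTE; apply: contra z1 => /eqP QL.
by rewrite /z QL divff ?ln1 // gt_eqF ?mulr_gt0.
Qed.

(** * Sums over incident pairs, and weak duality at positive rates *)

Section Duality.
Variables (R : realType) (J : finType) (routes : {set {set J}}).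
Variables (C : J -> R) (U : route routes -> R -> R).
Implicit Types (m : incidence routes -> R) (mbar L : route routes -> R).

Lemma sum_incidence (F : J -> route routes -> R) :
  \sum_(k : incidence routes) F (val k).1 (val k).2 =
  \sum_j \sum_(i : route routes | j \in val i) F j i.
Proof.
rewrite -(big_sub _ (fun p : J * route routes => F p.1 p.2)).
by rewrite pair_big_dep.
Qed.

Lemma sum_queue (F : J -> route routes -> R) j :
  \sum_(k : incidence routes | (val k).1 == j) F (val k).1 (val k).2 =
  \sum_(i : route routes | j \in val i) F j i.
Proof.
rewrite big_mkcond (sum_incidence (fun j' i => if j' == j then F j' i else 0)).
rewrite (bigD1 j) //= eqxx [X in _ + X]big1 ?addr0 // => j' /negbTE ->.
exact: big1.
Qed.

Lemma sum_route (F : J -> route routes -> R) i :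
  \sum_(k : incidence routes | (val k).2 == i) F (val k).1 (val k).2 =
  \sum_(j | j \in val i) F j i.
Proof.
rewrite big_mkcond (sum_incidence (fun j i' => if i' == i then F j i' else 0)).
rewrite [RHS]big_mkcond; apply: eq_bigr => j _.
rewrite big_mkcond (bigD1 i) //=.
rewrite eqxx [X in _ + X]big1 ?addr0 // => i' /negbTE ->.
by case: ifP.
Qed.

Hypothesis C_gt0 : forall j, 0 < C j.

Definition entropy m : R := \sum_(k | 0 < queue_total m (val k).1)
  m k * ln (m k * C (val k).1 / queue_total m (val k).1).

Lemma queue_total_ge m (k : incidence routes) :
  nonneg m -> m k <= queue_total m (val k).1.
Proof.
move=> m0; rewrite /queue_total (bigD1 k) //= lerDl.
by apply: sumr_ge0 => k' _; exact: m0.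
Qed.

Lemma queue_total_eq0 m (k : incidence routes) :
  nonneg m -> ~~ (0 < queue_total m (val k).1) ->
  queue_total m (val k).1 = 0 /\ m k = 0.
Proof.
move=> m0; rewrite -leNgt => Q0; have mQ := queue_total_ge k m0.
have := m0 k; lra.
Qed.

Lemma sum_route_total m (F : route routes -> R) :
  \sum_i route_total m i * F i = \sum_k m k * F (val k).2.
Proof.
rewrite (partition_big (fun k : incidence routes => (val k).2) xpredT) //=.
apply: eq_bigr => i _; rewrite /route_total mulr_suml.
by apply: eq_bigr => k /eqP <-.
Qed.

(** Grouped by queue, the left side is [queue_total m j] times the relative load of [j], which is at
    most 1. *)
Lemma sum_queue_load_le m L : nonneg m -> capacity_ok C L ->
  \sum_(k : incidence routes)
    queue_total m (val k).1 * L (val k).2 / C (val k).1 <= \sum_k m k.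
Proof.
move=> m0 Lcap; have Q0 j : 0 <= queue_total m j.
  by apply: sumr_ge0 => k _; exact: m0.
rewrite (sum_incidence (fun j i => queue_total m j * L i / C j)).
rewrite [leRHS](partition_big
  (fun k : incidence routes => (val k).1) xpredT) //=.
apply: ler_sum => j _; rewrite -mulr_suml -mulr_sumr -/(queue_total m j).
rewrite -mulrA ler_piMr // ler_pdivrMr // mul1r; exact: Lcap.
Qed.

Lemma entropy_ge m L : nonneg m -> (forall i, 0 < L i) -> capacity_ok C L ->
  \sum_i route_total m i * ln (L i) <= entropy m /\
  (entropy m <= \sum_i route_total m i * ln (L i) ->
    forall k : incidence routes,
      queue_total m (val k).1 * L (val k).2 = m k * C (val k).1).
Proof.
move=> m0 L0 Lcap; rewrite sum_route_total.
(* Extending the entropy terms by 0 lets the sum run over all pairs; in an empty queue the gap is 0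
   and the equality case reads [0 = 0]. *)
pose e (k : incidence routes) := if 0 < queue_total m (val k).1
  then m k * ln (m k * C (val k).1 / queue_total m (val k).1) else 0.
have -> : entropy m = \sum_k e k by rewrite /entropy big_mkcond.
have eP (k : incidence routes) :
    m k - queue_total m (val k).1 * L (val k).2 / C (val k).1 <=
    e k - m k * ln (L (val k).2)
    ?= iff (queue_total m (val k).1 * L (val k).2 == m k * C (val k).1).
  rewrite /e; case: ifPn => [Q0|/(queue_total_eq0 m0)[-> ->]].
    exact: entropy_term_ge.
  by rewrite !mul0r subrr; split; rewrite ?eqxx.
have mQ := sum_queue_load_le m0 Lcap.
have e_ge : \sum_(k : incidence routes)
      (m k - queue_total m (val k).1 * L (val k).2 / C (val k).1) <=
    \sum_k (e k - m k * ln (L (val k).2)).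
  by apply: ler_sum => k _; rewrite (eP k).
rewrite !sumrB in e_ge; split=> [|ent_le k]; first lra.
(* Nonnegative gaps whose sum is 0 all vanish, and a zero gap is the equality case of [eP]. *)
have dk0 (k' : incidence routes) : true ->
    0 <= e k' - m k' * ln (L (val k').2) -
    (m k' - queue_total m (val k').1 * L (val k').2 / C (val k').1).
  by move=> _; rewrite subr_ge0 (eP k').
have sum0 : \sum_(k' : incidence routes) (e k' - m k' * ln (L (val k').2) -
    (m k' - queue_total m (val k').1 * L (val k').2 / C (val k').1)) = 0.
  by apply: le_anti; rewrite sumr_ge0 // andbT !sumrB; lra.
have /eqP := psumr_eq0P dk0 sum0 (erefl : xpredT k).
by rewrite subr_eq0 eq_sym (eP k) => /eqP.
Qed.

Lemma dual_objectiveE L : (forall i, 0 < L i) ->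
  dual_objective U L = (\sum_i U i (L i))%:E.
Proof.
move=> L0; rewrite /dual_objective -sumEFin; apply: eq_bigr => i _.
by rewrite /utility_ext gt_eqF.
Qed.

Lemma weak_duality m mbar L : primal_feasible routes (m, mbar) ->
  (forall i, 0 < L i) -> capacity_ok C L ->
  (dual_objective U L <= primal_objective C U (m, mbar))%E.
Proof.
move=> [/= m0 mbar0 mmbar] L0 Lcap; rewrite dual_objectiveE //.
rewrite /primal_objective /= -/(entropy m).
have conj_le i : (conj_util (U i) (mbar i) <=
    (mbar i * ln (L i) - U i (L i))%:E)%E.
  rewrite -leeN2 -EFinN opprB.
  by have := conj_util_ge (U i) (mbar i) (ln (L i)); rewrite lnK // posrE.
apply: (@le_trans _ _ ((entropy m)%:E -
    (\sum_i (mbar i * ln (L i) - U i (L i)))%:E)%E).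
  rewrite -EFinB lee_fin sumrB; have [+ _] := entropy_ge m0 L0 Lcap.
  by rewrite (eq_bigr _ (fun i _ => congr1 ( *%R^~ _) (mmbar i))); lra.
by rewrite leeD2l // leeN2 -sumEFin; apply: lee_sum.
Qed.

End Duality.

(** * The optimality system: equivalence with a zero duality gap, and solvability *)

Section Kkt.
Variables (R : realType) (J : finType) (routes : {set {set J}}).
Variables (C : J -> R) (U : route routes -> R -> R).
Implicit Types (m : incidence routes -> R) (mbar L : route routes -> R).
Hypothesis C_gt0 : forall j, 0 < C j.
Hypothesis U_incr : forall i (x y : R), 0 < x -> x < y -> U i x < U i y.
Hypothesis U_derivable : forall i (x : R), 0 < x -> derivable (U i) x 1.
Hypothesis G_fin :
  forall i (x : R), 0 < x -> conj_util (U i) x \is a fin_num.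
Hypothesis G_derivable :
  forall i (x : R), 0 < x -> derivable (conj_util_fin (U i)) x 1.
Hypothesis G_onto : forall i (y : R),
  exists2 x : R, 0 < x & derive1 (conj_util_fin (U i)) x = y.

Definition kkt m mbar L : Prop :=
  [/\ forall i, route_total m i = mbar i,
      capacity_ok C L,
      forall k : incidence routes,
        queue_total m (val k).1 * L (val k).2 = m k * C (val k).1
    & forall i, 0 < mbar i /\
        expR (derive1 (conj_util_fin (U i)) (mbar i)) = L i].

Lemma dual_objective_eqNy L i : L i = 0 -> dual_objective U L = -oo%E.
Proof.
move=> Li0; apply/esum_eqNyP; exists i; split=> //.
rewrite Li0.
exact: utility_ext0 (@U_derivable i) (@G_fin i) (@G_derivable i) (G_onto i).
Qed.

Lemma dual_objective_gt0 L : nonneg L -> dual_objective U L != -oo%E ->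
  forall i, 0 < L i.
Proof.
move=> L0 /eqP LNy i; rewrite lt0r L0 andbT; apply/eqP => Li0.
by apply: LNy; exact: dual_objective_eqNy Li0.
Qed.

Lemma weak_duality_nonneg m mbar L : primal_feasible routes (m, mbar) ->
  dual_feasible routes C L ->
  (dual_objective U L <= primal_objective C U (m, mbar))%E.
Proof.
move=> pf [L0 Lcap]; have [->|LNy] := eqVneq (dual_objective U L) -oo%E.
  by rewrite leNye.
by apply: weak_duality => //; exact: dual_objective_gt0.
Qed.

(** The third condition turns the ratio inside each logarithm into [L i], and the fourth makes
    [ln (L i)] the maximizer defining [G] at [mbar i]; the terms [mbar i * ln (L i)] then cancel. *)
Lemma kkt_objective m mbar L : nonneg m -> kkt m mbar L ->
  primal_objective C U (m, mbar) = dual_objective U L.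
Proof.
move=> m0 [mmbar Lcap mL mbarL].
have L0 i : 0 < L i by have [_ <-] := mbarL i; exact: expR_gt0.
rewrite dual_objectiveE // /primal_objective /= -/(entropy C m).
have -> : entropy C m = \sum_i mbar i * ln (L i).
  under eq_bigr do rewrite -mmbar; rewrite sum_route_total /entropy big_mkcond.
  apply: eq_bigr => k _; case: ifPn => [Q0|]; last first.
    by move=> /(queue_total_eq0 m0)[_ ->]; rewrite mul0r.
  by rewrite -mL mulrAC divff ?mul1r // gt_eqF.
have -> : (\sum_i conj_util (U i) (mbar i) =
    (\sum_i (mbar i * ln (L i) - U i (L i)))%:E)%E.
  rewrite -sumEFin; apply: eq_bigr => i _; have [mb0 <-] := mbarL i.
  rewrite (conj_util_finE (@G_fin i)) // expRK; congr (_%:E).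
  have := conj_util_derive1E (@U_derivable i) (@G_fin i) (@G_derivable i) mb0.
  by move=> e; rewrite -opprB -e opprK.
by rewrite -EFinB sumrB opprB addrC subrK.
Qed.

Lemma objective_kkt m mbar L : primal_feasible routes (m, mbar) ->
  dual_feasible routes C L -> dual_objective U L != -oo%E ->
  primal_objective C U (m, mbar) = dual_objective U L -> kkt m mbar L.
Proof.
move=> [/= m0 mbar0 mmbar] [L_ge0 Lcap] LNy.
have L0 := dual_objective_gt0 L_ge0 LNy.
rewrite dual_objectiveE // /primal_objective /= -/(entropy C m) => PD.
(* [G_fin] covers positive arguments only, and at 0 the conjugate may be -oo; equality with the
   finite dual value excludes this. *)
have conj_fin i : conj_util (U i) (mbar i) \is a fin_num.
  have : (\sum_i conj_util (U i) (mbar i))%E \is a fin_num.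
    by move: PD; case: (\sum_i _)%E.
  by move/sum_fin_numP; apply; rewrite ?mem_index_enum.
pose g i := fine (conj_util (U i) (mbar i)).
have gE i : conj_util (U i) (mbar i) = (g i)%:E by rewrite fineK.
have g_le i : true -> 0 <= mbar i * ln (L i) - U i (L i) - g i.
  move=> _; rewrite subr_ge0.
  have := conj_util_ge (U i) (mbar i) (ln (L i)).
  by rewrite gE -EFinN lee_fin lnK ?posrE //; lra.
have [ent_ge ent_eq] := entropy_ge C_gt0 m0 L0 Lcap.
have rtE : \sum_i route_total m i * ln (L i) = \sum_i mbar i * ln (L i).
  by apply: eq_bigr => i _; rewrite mmbar.
rewrite {}rtE in ent_ge ent_eq.
move: PD; under eq_bigr do rewrite gE.
rewrite sumEFin -EFinB => -[PD].
(* The entropy gap and the conjugacy gaps are nonnegative with total 0, so each of them is 0. *)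
have sum0 : \sum_i (mbar i * ln (L i) - U i (L i) - g i) = 0.
  by apply: le_anti; rewrite sumr_ge0 // andbT !sumrB; lra.
have gi := psumr_eq0P g_le sum0; rewrite !sumrB in sum0.
split=> // [|i]; first by apply: ent_eq; lra.
have ge : (- conj_util (U i) (mbar i) =
    (U i (expR (ln (L i))) - mbar i * ln (L i))%:E)%E.
  by rewrite gE -EFinN lnK ?posrE //; congr (_%:E); have := gi i isT; lra.
have mb0 := conj_util_eq_gt0 (@U_incr i) (mbar0 i) ge.
split=> //.
rewrite (derive1_conj_util (@G_fin i) (@G_derivable i) mb0 (l := ln (L i))).
  by rewrite lnK ?posrE.
by apply: EFin_inj; rewrite EFinN -(conj_util_finE (@G_fin i) mb0).
Qed.

Hypothesis routes_nonempty : finset.set0 \notin routes.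

(** A nonempty route meets some queue, whose capacity bounds its rate. The bound is common to all
    routes, and the [1 +] makes it positive even when [J] is empty. *)
Lemma feasible_route_le L i :
  nonneg L -> capacity_ok C L -> L i <= 1 + \sum_j C j.
Proof.
move=> L0 Lcap; have C_ge0 j : 0 <= C j by exact: ltW.
have /set0Pn[j ji] : val i != finset.set0.
  by apply: contraNneq routes_nonempty => <-; exact: valP.
apply: (@le_trans _ _ (C j)).
  apply: le_trans (Lcap j); rewrite (bigD1 i) //= lerDl.
  exact: sumr_ge0.
rewrite (bigD1 j) //=; have : 0 <= \sum_(j' | j' != j) C j' by exact: sumr_ge0.
by lra.
Qed.

Lemma capacity_const :
  exists2 e : R, 0 < e & capacity_ok C (fun _ : route routes => e).
Proof.
pose n : R := #|{: route routes}|%:R.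
(* [D] exceeds every [n / C j], so [n] routes of rate [D^-1] overload no queue. *)
pose D := 1 + \sum_j n / C j.
have n0 : 0 <= n by exact: ler0n.
have nC0 j : 0 <= n / C j by rewrite divr_ge0 // ltW.
have D0 : 0 < D by rewrite ltr_wpDr // sumr_ge0.
exists D^-1 => [|j]; first by rewrite invr_gt0.
apply: (@le_trans _ _ (n * D^-1)).
  rewrite big_mkcond mulr_natl -sumr_const; apply: ler_sum => i _.
  by case: ifP => // _; rewrite invr_ge0 ltW.
rewrite ler_pdivrMr // mulrC -ler_pdivrMr // /D (bigD1 j) //=.
have : 0 <= \sum_(j' | j' != j) n / C j' by exact: sumr_ge0.
by lra.
Qed.

Lemma dual_argmax : exists l : route routes -> R,
  capacity_ok C (expR \o l) /\
  forall l', capacity_ok C (expR \o l') ->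
    \sum_i U i (expR (l' i)) <= \sum_i U i (expR (l i)).
Proof.
have [e e0 ecap] := capacity_const.
pose B := 1 + \sum_j C j.
have B0 : 0 < B by rewrite ltr_wpDr // sumr_ge0 // => j _; exact: ltW.
pose f (l : route routes -> R) := \sum_i U i (expR (l i)).
pose S := [set l : route routes -> R | capacity_ok C (expR \o l)].
have Sb l : S l -> forall i, l i <= ln B.
  move=> Sl i; rewrite -ler_expR lnK ?posrE //.
  apply: (@feasible_route_le (expR \o l)) => // i' /=; exact: expR_ge0.
have UB l : S l -> forall i, U i (expR (l i)) <= U i B.
  move=> /Sb/[swap] i/(_ i); rewrite -ler_expR lnK ?posrE //.
  rewrite le_eqVlt => /predU1P[->//|lB].
  by rewrite ltW // U_incr // expR_gt0.
pose l0 : route routes -> R := fun=> ln e.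
have Sl0 : S l0 by move=> j /=; rewrite /l0 lnK ?posrE //; exact: ecap.
(* Feasible points have [U i' (expR (l i')) <= U i' B] for all [i']; a single coordinate below [a i]
   therefore puts the objective below its value at [l0]. *)
have /choice[a aP] : forall i, exists a, forall y, y < a ->
    U i (expR y) < f l0 - \sum_(i' | i' != i) U i' B.
  move=> i.
  exact: util_exp_lt (@U_derivable i) (@G_fin i) (@G_derivable i) (@G_onto i) _.
have f_lt l i : S l -> l i < a i -> f l < f l0.
  move=> Sl lia; rewrite /f (bigD1 i) //=.
  apply: (@lt_le_trans _ _ (f l0 - \sum_(i' | i' != i) U i' B +
    \sum_(i' | i' != i) U i' B)); last by rewrite subrK.
  by apply: ltr_leD; [exact: aP | apply: ler_sum => i' _; exact: UB].
have l0_box i : a i <= l0 i <= ln B.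
  by rewrite Sb // andbT leNgt; apply/negP => /(f_lt _ _ Sl0); rewrite ltxx.
have [|||l [Sl _ lmax]] := @box_EVT_max_sum R _ _ a (fun=> ln B)
  (fun j (i : route routes) => j \in val i) (fun=> expR)
  (fun i y => U i (expR y)) C.
- by move=> i; exact: continuous_expR.
- by move=> i; exact: util_exp_continuous (@U_derivable i).
- by exists l0.
(* Feasible points leave the box only through its lower faces, where they are worse than [l0],
   itself in the box. *)
exists l; split=> // l' Sl'; have [l'a|] := pselect (forall i, a i <= l' i).
  by apply: lmax => // i; rewrite l'a Sb.
move=> /existsNP[i /negP]; rewrite -ltNge => /(f_lt _ _ Sl')/ltW fl'.
by apply: le_trans fl' _; exact: lmax.
Qed.

Lemma kkt_exists : exists m mbar L, nonneg m /\ kkt m mbar L.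
Proof.
have [l [lcap lmax]] := dual_argmax.
pose L i := expR (l i); have L0 i : 0 < L i by exact: expR_gt0.
(* [x i] is the point where the derivative of [G] is [l i]; it will serve as [mbar i]. *)
have /choice[x xP] := fun i => conj_util_slope (@U_derivable i) (@G_fin i)
  (@G_derivable i) (@G_onto i) (l i).
have dU i : is_derive (L i) 1 (U i) (x i / L i).
  by have [_ _ xV] := xP i; exact: (is_derive_util (@U_derivable i)).
pose load L j := \sum_(i : route routes | j \in val i) L i.
pose tight j := load L j == C j.
(* Rows of slack queues are zero, so they put no condition on a direction [d]. *)
pose A j (i : route routes) : R := (tight j && (j \in val i))%:R.
have A_sum j (d : route routes -> R) :
    \sum_i A j i * d i = if tight j then load d j else 0.
  rewrite /A /load; case: (tight j) => /=; last first.
    by apply: big1 => i _; rewrite mul0r.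
  rewrite [RHS]big_mkcond; apply: eq_bigr => i _.
  by case: ifP => _; rewrite ?mul1r ?mul0r.
have [|d dA|p [p0 pA]] := @farkas_nonneg R J _ A (fun i => x i / L i).
- by move=> j i; exact: ler0n.
(* A direction that raises the load of no tight queue stays feasible for small [t > 0]: slack queues
   have room and positive rates stay positive. The objective cannot grow along it. *)
- apply: (@sum_slope_le0 _ _ (fun i t => U i (L i + t * d i))) => [i|].
    have dg : is_derive (0 : R) 1 (fun t => L i + t * d i) (d i).
      have /is_derive_eq := is_deriveD (is_derive_cst (L i) (0 : R) 1)
        (is_deriveM (is_derive_id (0 : R) 1) (is_derive_cst (d i) (0 : R) 1)).
      by apply; rewrite /= scaler0 !add0r -[d i *: 1]/(d i * 1) mulr1.
    apply: (is_derive1_comp _ dg); rewrite mul0r addr0; exact: dU.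
  have Lpos : \forall t \near 0^'+, forall i, 0 < L i + t * d i.
    apply: filter_forall => i.
    have := near_right_mulr_lt (- d i) (L0 i); apply: filterS => t.
    by rewrite mulrN -subr_gt0 opprK.
  have Lcap : \forall t \near 0^'+, forall j,
      load (fun i => L i + t * d i) j <= C j.
    apply: filter_forall => j.
    have loadD t : load (fun i => L i + t * d i) j = load L j + t * load d j.
      by rewrite /load big_split /= mulr_sumr.
    have := lcap j; rewrite le_eqVlt => /orP[tj|]; last first.
      rewrite -subr_gt0 => /(near_right_mulr_lt (load d j)).
      by apply: filterS => t tC; rewrite loadD -lerBrDl ltW.
    near=> t; have t0 : 0 < t by near: t; exact: nbhs_right_gt.
    have Lj : load L j = C j by exact/eqP.
    have := dA j; rewrite A_sum /tight loadD Lj eqxx => dj.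
    by rewrite gerDl pmulr_rle0.
  near=> t; have Lt0 : forall i, 0 < L i + t * d i by near: t.
  have Ltcap : forall j, load (fun i => L i + t * d i) j <= C j by near: t.
  have := lmax (fun i => ln (L i + t * d i)).
  under eq_bigr do rewrite lnK ?posrE //.
  under [X in _ -> _ <= X]eq_bigr do rewrite mul0r addr0.
  apply=> j; rewrite (eq_bigr (fun i => L i + t * d i)) => [|i _ /=].
    exact: Ltcap.
  by rewrite lnK ?posrE.
(* Zeroing the multipliers of slack queues gives complementary slackness,
   [q j * load L j = q j * C j]. *)
pose q j := if tight j then p j else 0.
have q0 j : 0 <= q j by rewrite /q; case: ifP.
have q_sum (i : route routes) : \sum_(j | j \in val i) q j = x i / L i.
  rewrite pA [LHS]big_mkcond; apply: eq_bigr => j _; rewrite /q /A.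
  by case: (tight j); case: (j \in val i); rewrite /= ?mulr1 ?mulr0 ?mul0r.
exists (fun k => q (val k).1 * L (val k).2), x, L; split=> [k|].
  by rewrite mulr_ge0 // ltW.
split=> // [i|k|i].
- rewrite /route_total (sum_route (fun j i => q j * L i)) -mulr_suml q_sum.
  by rewrite divfK // gt_eqF.
- rewrite /queue_total (sum_queue (fun j i => q j * L i)) -mulr_sumr.
  rewrite -/(load L (val k).1) /q; case: ifP => [/eqP->|_].
    by rewrite mulrAC.
  by rewrite !mul0r.
- by have [x0 xl _] := xP i; rewrite xl.
Unshelve. all: by end_near. Qed.

End Kkt.

(** * Strong duality and characterization of the optimizers *)

Theorem theorem5p3 (R : realType) (J : finType) (routes : {set {set J}})
  (C : J -> R) (U : route routes -> R -> R)
  (routes_nonempty : finset.set0 \notin routes)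
  (C_gt0 : forall j, 0 < C j)
  (U_increasing : forall i (x y : R), 0 < x -> x < y -> U i x < U i y)
  (U_concave : forall i, strictly_concave_on [set x : R | 0 < x] (U i))
  (U_derivable : forall i (x : R), 0 < x -> derivable (U i) x 1)
  (U_derive0 : forall i, derive1 (U i) x @[x --> (0 : R)^'+] --> +oo)
  (assumption1 : forall i,
    strictly_concave_on [set: R] (fun l => U i (expR l)))
  (G_finite : forall i (x : R), 0 < x -> conj_util (U i) x \is a fin_num)
  (G_concave : forall i,
    strictly_concave_on [set x : R | 0 < x] (conj_util_fin (U i)))
  (G_derivable : forall i (x : R), 0 < x -> derivable (conj_util_fin (U i)) x 1)
  (G_C1 : forall i (x : R), 0 < x ->
    {for x, continuous (derive1 (conj_util_fin (U i)))})
  (G_derive_onto : forall i (y : R),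
    exists2 x : R, 0 < x & derive1 (conj_util_fin (U i)) x = y) :
  [/\ is_min (primal_objective C U @` primal_feasible routes) (beta_G C U),
      is_max (dual_objective U @` dual_feasible routes C) (beta_G C U)
    & forall (m : incidence routes -> R) (mbar L : route routes -> R),
      nonneg m -> nonneg mbar -> nonneg L ->
      (minimizes (primal_feasible routes) (primal_objective C U) (m, mbar) /\
       maximizes (dual_feasible routes C) (dual_objective U) L)
      <->
      [/\ forall i, route_total m i = mbar i,
          capacity_ok C L,
          forall k : incidence routes,
            queue_total m (val k).1 * L (val k).2 = m k * C (val k).1
        & forall i, 0 < mbar i /\
            expR (derive1 (conj_util_fin (U i)) (mbar i)) = L i]].
Proof.
have [m0 [mbar0 [L0 [m0_ge0 kkt0]]]] := kkt_exists C_gt0 U_increasing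
  U_derivable G_finite G_derivable G_derive_onto routes_nonempty.
pose P := primal_objective C U; pose D := dual_objective U.
have weak p L : primal_feasible routes p -> dual_feasible routes C L ->
    (D L <= P p)%E.
  case: p => m mbar; exact: (weak_duality_nonneg C_gt0 U_derivable G_finite
    G_derivable G_derive_onto).
have kkt_feasible m mbar L : nonneg m -> kkt C U m mbar L ->
    [/\ primal_feasible routes (m, mbar), dual_feasible routes C L,
       P (m, mbar) = D L & D L != -oo%E].
  move=> m_ge0 K; have [mmbar Lcap _ mbarL] := K; split.
  - by split=> //= i; have [/ltW] := mbarL i.
  - by split=> // i; have [_ <-] := mbarL i; exact: expR_ge0.
  - exact: (kkt_objective U_derivable G_finite G_derivable m_ge0 K).
  - rewrite /D dual_objectiveE // => i; have [_ <-] := mbarL i.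
    exact: expR_gt0.
have [pf0 df0 PD0 DNy0] := kkt_feasible _ _ _ m0_ge0 kkt0.
(* A solution of the system has equal primal and dual values, so weak duality certifies both as
   optimal. *)
have betaE : beta_G C U = P (m0, mbar0).
  apply/le_anti/andP; split.
    by apply: ereal_inf_lbound; exists (m0, mbar0).
  by apply: le_ereal_inf_tmp => _ [p pf <-]; rewrite PD0; exact: weak.
split.
- split; first by exists (m0, mbar0).
  by move=> _ [p pf <-]; rewrite betaE PD0; exact: weak.
- split; first by exists L0; rewrite // betaE PD0.
  by move=> _ [L df <-]; rewrite betaE; exact: weak.
move=> m mbar L m_ge0 mbar_ge0 L_ge0; split=> [[[pf Pmin] [df Dmax]]|K].
  (* Optimality on both sides sandwiches the values: [P (m, mbar) <= P (m0, mbar0) = D L0 <= D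
     L]. *)
  have PD : P (m, mbar) = D L.
    apply/le_anti; rewrite weak // andbT.
    by apply: le_trans (Pmin _ pf0) _; rewrite -/P PD0; exact: Dmax.
  apply: (objective_kkt C_gt0 U_increasing U_derivable G_finite G_derivable
    G_derive_onto pf df _ PD).
  (* The maximal dual value is at least [D L0], hence not -oo. *)
  apply: contra_neq DNy0 => DNy; apply/eqP; rewrite -leeNy_eq -DNy.
  exact: Dmax.
have [pf df PD _] := kkt_feasible _ _ _ m_ge0 K.
split; split=> // y yf.
- by rewrite -/P PD; exact: weak.
- by rewrite -/D -PD; exact: weak.
Qed.
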